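(* Let $s<t$ and $M$ be real numbers. There exist constants $c$ and $0<\rho<1$, depending only on $s,t$ and $M$, such that the following holds. Let $(X_{m,n})_{1\le m\le n}$ be an array of real-valued random variables that is stationary and subadditive, and suppose that $X_{1,1}\le M$ almost everywhere. Put $S_n=\frac1n X_{1,n}$. Then for every positive integer $k$, $$\mathbb P\big((S_n)_{n=1}^\infty \text{ has } k\text{ upcrossings of }[s,t]\big)<c\cdot\rho^k .$$
   Context: The array is stationary if for every $l\in\mathbb N$ the arrays $(X_{m,n})_{1\le m\le n}$ and $(X_{m+l,n+l})_{1\le m\le n}$ have the same distribution. It is subadditive if $X_{k,n}\le X_{k,m}+X_{m+1,n}$ whenever $1\le k\le m<n$. A sequence $(x_n)_{n=1}^\infty$ of real numbers has $k$ upcrossings of $[s,t]$ if there are indices $1\le i_1<j_1<i_2<j_2<\cdots<i_k<j_k$ such that $x_{i_m}<s$ and $x_{j_m}>t$ for $m=1,\dots,k$. *)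

(* Defs.v *)
From HB Require Import structures.
From mathcomp Require Import all_boot all_order all_algebra.
From mathcomp Require Import all_classical all_reals all_analysis.
Set Implicit Arguments.
Unset Strict Implicit.
Unset Printing Implicit Defensive.
Import Order.TTheory GRing.Theory Num.Theory.
Local Open Scope classical_set_scope.
Local Open Scope ring_scope.

(* A triangular array (X_{m,n})_{1 <= m <= n} is encoded by a function of two
   naturals; its values outside 1 <= m <= n are junk, and no definition below
   looks at them. *)

Definition array_cylinder (R : realType) : set (set (nat -> nat -> R)) :=
  [set C | exists m n (B : set R),
     [/\ (1 <= m <= n)%N, measurable B & C = [set x | B (x m n)]]].

(* Equality of the laws of the whole arrays on the product sigma-algebra, i.e.
   the one generated by the coordinates (m, n) with 1 <= m <= n. *)
Definition same_array_law d (T : measurableType d) (R : realType)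
    (P : probability T R) (X Y : nat -> nat -> {RV P >-> R}) : Prop :=
  forall A : set (nat -> nat -> R), <<s @array_cylinder R >> A ->
    P ((fun w m n => X m n w) @^-1` A) = P ((fun w m n => Y m n w) @^-1` A).

Definition stationary_array d (T : measurableType d) (R : realType)
    (P : probability T R) (X : nat -> nat -> {RV P >-> R}) : Prop :=
  forall l : nat, same_array_law X (fun m n => X (m + l)%N (n + l)%N).

(* As usual for random variables, each inequality is meant almost surely. *)
Definition subadditive_array d (T : measurableType d) (R : realType)
    (P : probability T R) (X : nat -> nat -> {RV P >-> R}) : Prop :=
  forall k m n : nat, (1 <= k)%N -> (k <= m)%N -> (m < n)%N ->
    {ae P, forall w, X k n w <= X k m w + X m.+1 n w}.

(* The sequence is x_1, x_2, ... (x 0 is ignored), and the indices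
   i_1 < j_1 < ... < i_k < j_k are i 1, j 1, ..., i k, j k. *)
Definition has_upcrossings (R : realType) (x : nat -> R) (s t : R) (k : nat) :
    Prop :=
  exists i j : nat -> nat,
    [/\ (1 <= i 1)%N,
        forall m, (1 <= m <= k)%N -> (i m < j m)%N,
        forall m, (1 <= m < k)%N -> (j m < i m.+1)%N &
        forall m, (1 <= m <= k)%N -> x (i m) < s /\ t < x (j m)].

(* Main.v *)
Require Import Defs.
From HB Require Import structures.
From mathcomp Require Import all_boot all_order all_algebra.
From mathcomp Require Import all_classical all_reals all_analysis.
From mathcomp Require Import measurable_realfun.
From mathcomp Require Import zify ring lra.
Set Implicit Arguments.
Unset Strict Implicit.
Unset Printing Implicit Defensive.
Import Order.TTheory GRing.Theory Num.Theory.
Local Open Scope classical_set_scope.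
Local Open Scope ring_scope.

(** Raise [M] so that [t < M]. Almost surely the deficit
    [Y(y, e) = M e - X_{1+y, e+y}] is nonnegative and superadditive, hence
    monotone in [e], and an upcrossing of [[s, t]] by the averages started at
    [y] is a pair of lengths [h < l] such that the interval [[y, y+h)] is
    high, [Y > beta h], and [[y, y+l)] is low, [Y < alpha l], where
    [alpha = M - t < beta = M - s]. Monotonicity forces [h < theta l] with
    [theta = alpha / beta < 1], so the lengths in a chain of crossings grow
    geometrically.

    By stationarity, the probability of [k] upcrossings within a window of
    length [L] is the mean proportion of starting points [y < n] from which
    [k] crossings occur within [L]. So it suffices to prove a deterministic
    statement about one superadditive array. Let [N y e] be the number of
    crossings from [y] with lengths at most [e], and let the mass of an
    interval [K] be the sum over [y] in [K] of [lam ^ N y e], with [e] the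
    distance from [y] to the right end of [K]. Claim: if [lam > 1] is close
    enough to 1, then [mass K <= C |K|] for a constant [C]
    ([fluctuation_mass_bound]). Then at most a proportion [C lam^-k] of points
    have [k] crossings, which gives the theorem with [rho = 1/lam].

    The claim is proved by induction on [|K|], cutting [K] into pieces.
    Cutting at a point loses the crossings that overhang the cut. If these
    have lengths at most [l], geometric growth shows that a point at distance
    [theta^r l] from the cut loses at most about [r] of them; such points are rare,
    and the total loss is at most [eps C l], where [eps] tends to 0 with
    [lam - 1] ([overhang_mass]). Cutting around the longest interval of a
    given kind inside [K] therefore costs at most [2 eps C] times its length,
    and repeating this exhausts [K] ([mass_le_superadditive]). Doing so with
    low intervals reduces the claim to a low [K] (with some room to pay for
    the cuts); doing so with high intervals inside a low [K], the disjoint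
    high intervals have total length at most [theta |K|] because [Y] is
    superadditive, and the induction hypothesis on them gives a bound
    [|K| + (1 + O(eps)) theta C |K|], which leaves the required room when [C]
    is large. *)

(** * Chains of alternating crossings *)

Section Chain.
Variables hi lo : pred nat.

(** A chain of [n] steps is an increasing sequence of [n] positive lengths, all
    at most [e], which are alternately in [hi] and in [lo], starting with [hi].
    The bounded index is the predecessor of the length, so that length 0 never
    occurs. *)
Fixpoint chain (n e : nat) : bool :=
  if n is n'.+1 then
    [exists i : 'I_e, (if odd n then hi i.+1 else lo i.+1) && chain n' i]
  else true.

Lemma chainSP n e :
  reflect (exists i, [/\ (i < e)%N, (if odd n.+1 then hi i.+1 else lo i.+1)
                       & chain n i])
          (chain n.+1 e).
Proof.
apply: (iffP existsP) => [[i /andP[ai ci]]|[i [ie ai ci]]].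
  by exists i; split.
by exists (Ordinal ie); apply/andP.
Qed.

Lemma chain_widen n e e' : (e <= e')%N -> chain n e -> chain n e'.
Proof.
case: n => // n ee' /chainSP[i [ie ai ci]].
by apply/chainSP; exists i; split => //; exact: leq_trans ee'.
Qed.

Lemma chainW n e : chain n.+1 e -> chain n e.
Proof. by case/chainSP=> i [/ltnW ie _]; exact: chain_widen. Qed.

Lemma leq_chain n e : chain n e -> (n <= e)%N.
Proof.
elim: n e => // n IHn e /chainSP[i [ie _ /IHn ni]].
exact: leq_ltn_trans ie.
Qed.

Lemma chain_end n e : chain n.+1 e ->
  exists l, [/\ (0 < l <= e)%N, (if odd n.+1 then hi l else lo l)
              & chain n.+1 l].
Proof.
case/chainSP=> i [ie ai ci]; exists i.+1; split => //.
by apply/chainSP; exists i.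
Qed.

Lemma chain_pairP k e :
  reflect (exists h l, [/\ (0 < h < l)%N, (l <= e)%N, hi h, lo l
                         & chain k.*2 h.-1])
          (chain k.+1.*2 e).
Proof.
rewrite doubleS; apply: (iffP (@chainSP k.*2.+1 e)) =>
    [[l [le lol /chainSP[h [hl hih c]]]]|[h [l]]].
  move: lol hih; rewrite /= negbK odd_double => lol hih.
  by exists h.+1, l.+1; split.
move=> [/andP[h0 hl] le hih lol c].
exists l.-1; split; first by clear -hl le; lia.
  by rewrite /= negbK odd_double (ltn_predK hl).
apply/chainSP; exists h.-1; split => //; first by clear -h0 hl; lia.
by rewrite /= odd_double (ltn_predK h0).
Qed.

(** The maximal numbers of low, respectively high, members of a chain of lengths
    at most [e]. They differ by at most one. [count_lo] is attained at a low
    length and [count_hi] at a high one, so that the longest low, respectively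
    high, length bounds the windows that matter for them. *)
Definition count_lo e := \max_(k < e.+1 | chain k.*2 e) k.
Definition count_hi e := \max_(k < e.+1 | chain k.*2.-1 e) k.

Lemma leq_count_lo k e : chain k.*2 e -> (k <= count_lo e)%N.
Proof.
move=> c; have ke : (k < e.+1)%N by have := leq_chain c; lia.
exact: (@leq_bigmax_cond _ (fun k : 'I_e.+1 => chain k.*2 e)
          (fun k => nat_of_ord k) (Ordinal ke)).
Qed.

Lemma leq_count_hi k e : chain k.*2.-1 e -> (k <= count_hi e)%N.
Proof.
move=> c.
have [ke|ke] := leqP k e.
  exact: (@leq_bigmax_cond _ (fun k : 'I_e.+1 => chain k.*2.-1 e)
          (fun k => nat_of_ord k) (Ordinal (ke : (k < e.+1)%N))).
by have := leq_chain c; case: (k) ke => // k'; rewrite doubleS /=; lia.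
Qed.

Lemma chain_count_lo e : chain (count_lo e).*2 e.
Proof.
rewrite /count_lo.
by case: (@eq_bigmax_cond _ (fun k : 'I_e.+1 => chain k.*2 e)
          (fun k => nat_of_ord k)) => [|k ck ->//];
  apply/card_gt0P; exists ord0.
Qed.

Lemma chain_count_hi e : chain (count_hi e).*2.-1 e.
Proof.
rewrite /count_hi.
by case: (@eq_bigmax_cond _ (fun k : 'I_e.+1 => chain k.*2.-1 e)
          (fun k => nat_of_ord k)) => [|k ck ->//];
  apply/card_gt0P; exists ord0.
Qed.

Lemma count_lo_mono e e' : (e <= e')%N -> (count_lo e <= count_lo e')%N.
Proof.
by move=> ee'; apply: leq_count_lo; apply: chain_widen ee' (chain_count_lo e).
Qed.

Lemma count_hi_mono e e' : (e <= e')%N -> (count_hi e <= count_hi e')%N.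
Proof.
by move=> ee'; apply: leq_count_hi; apply: chain_widen ee' (chain_count_hi e).
Qed.

Lemma count_lo_hi e : (count_lo e <= count_hi e)%N.
Proof.
apply: leq_count_hi; case: (count_lo e) (chain_count_lo e) => // k.
by rewrite doubleS => c; exact: chainW c.
Qed.

Lemma count_hi_lo e : (count_hi e <= (count_lo e).+1)%N.
Proof.
case: (count_hi e) (chain_count_hi e) => // k; rewrite doubleS /= ltnS.
by move=> c; apply: leq_count_lo; exact: chainW c.
Qed.

Lemma count_lo_end e : (0 < count_lo e)%N ->
  exists l, [/\ (0 < l <= e)%N, lo l & (count_lo e <= count_lo l)%N].
Proof.
have := chain_count_lo e; case E : (count_lo e) => [//|k]; rewrite doubleS.
case/chain_end => l [l0e /=]; rewrite negbK odd_double /= => lol c _.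
by exists l; split => //; apply: leq_count_lo; rewrite doubleS /= negbK odd_double.
Qed.

Lemma count_hi_end e : (0 < count_hi e)%N ->
  exists l, [/\ (0 < l <= e)%N, hi l & (count_hi e <= count_hi l)%N].
Proof.
have := chain_count_hi e; case E : (count_hi e) => [//|k]; rewrite doubleS.
case/chain_end => l [l0e /=]; rewrite odd_double /= => lol c _.
by exists l; split => //; apply: leq_count_hi; rewrite doubleS /= odd_double.
Qed.

(** If a high length below a low length at most [e] is always at most [r], then
    reducing the window from [e] to [r] costs one crossing only: all members of
    the chain but the last ones precede the last high length. *)
Variables (e r : nat).
Hypothesis shrink : forall h l, (0 < h)%N -> (h < l <= e)%N ->
  hi h -> lo l -> (h <= r)%N.

Lemma count_lo_shrink : (count_lo e <= (count_lo r).+1)%N.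
Proof.
case: (count_lo e) (chain_count_lo e) => // k.
case/chain_pairP => h [l [hl le hih lol c]]; rewrite ltnS.
apply: leq_count_lo; apply: chain_widen c.
have : (h <= r)%N by apply: (@shrink _ l); case/andP: hl => // _ ->.
lia.
Qed.

Lemma count_hi_shrink : (count_hi e <= (count_hi r).+1)%N.
Proof.
case: (count_hi e) (chain_count_hi e) => // k; rewrite doubleS ltnS.
case: k => // k; rewrite doubleS => /chainSP[h2 [h2e _]].
case/existsP => -[l lh2] /=; rewrite negbK odd_double /= => /andP[lol].
case/existsP => -[h hl] /= /andP[hih c].
apply: leq_count_hi; rewrite doubleS /=; apply/chainSP; exists h.
rewrite /= odd_double; split => //.
by apply: (@shrink _ l.+1) => //; lia.
Qed.

End Chain.

(** * The mass of an interval *)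

Section Mass.
Variables (R : realType) (lam : R) (N : nat -> nat -> nat).

Definition mass (a n : nat) : R := \sum_(i < n) lam ^+ N (a + i) (n - i).

Lemma mass_split a n m :
  mass a (n + m) = \sum_(i < n) lam ^+ N (a + i) (n + m - i) + mass (a + n) m.
Proof.
rewrite /mass big_split_ord /=; congr (_ + _).
by apply: eq_bigr => i _; rewrite addnA subnDl.
Qed.

(** [lam_eps] says that [eps C l] bounds the geometric series of losses in
    [overhang_mass]; it can be met for any [eps] by taking [lam] near 1. *)
Variables (eps theta C : R).
Hypothesis lam_gt1 : 1 < lam.
Hypothesis eps_gt0 : 0 < eps.
Hypothesis theta01 : 0 < theta < 1.
Hypothesis C_ge0 : 0 <= C.
Hypothesis lam_eps : lam - 1 + lam * eps * theta <= eps.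
Hypothesis N_mono : forall y, {homo N y : e e' / (e <= e')%N}.
Hypothesis N_shrink : forall y l,
  (N y l <= (N y (Num.truncn (theta * l%:R))).+1)%N.

Lemma truncn_shrink l :
  (Num.truncn (theta * l%:R))%:R <= theta * l%:R.
Proof. by rewrite truncn_le // mulr_ge0 // ltW //; case/andP: theta01. Qed.

(** Points closer than [l] to the right end of the interval are given a window
    of length [l] instead, which overhangs the end. Shrinking the overhang from
    [l] to [theta l] costs at most a factor [lam] at the points closer than [l],
    whose mass is at most [C l]; iterating gives a geometric series. *)
Lemma overhang_mass a n l :
  (forall m, (m <= n)%N -> (m < l)%N -> mass (a + (n - m)) m <= C * m%:R) ->
  \sum_(i < n) lam ^+ N (a + i) (maxn (n - i) l) <= mass a n + eps * C * l%:R.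
Proof.
elim/ltn_ind: l => -[|l] IH massC.
  rewrite mulr0 addr0; apply: ler_sum => i _.
  by rewrite maxn0.
set r := Num.truncn (theta * l.+1%:R).
have rl : (r < l.+1)%N.
  rewrite -(ltr_nat R); apply: le_lt_trans (truncn_shrink l.+1) _.
  by case/andP: theta01 => t0 t1; rewrite gtr_pMl.
pose m := minn n l.
have mn : (m <= n)%N by rewrite geq_minl.
have ml : (m < l.+1)%N by rewrite ltnS geq_minr.
(* The gain of mass due to an overhang [j] is [D j]. *)
pose D j := \sum_(i < n) (lam ^+ N (a + i) (maxn (n - i) j)
                          - lam ^+ N (a + i) (n - i)).
have DE j : \sum_(i < n) lam ^+ N (a + i) (maxn (n - i) j) = mass a n + D j.
  by rewrite /D big_split /= sumrN addrCA subrr addr0.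
have Dr : D r <= eps * C * r%:R.
  have := IH r rl; rewrite DE lerD2l; apply => m' m'n m'r.
  by apply: massC => //; exact: ltn_trans rl.
have massE : \sum_(i < n | (n - i < l.+1)%N) lam ^+ N (a + i) (n - i)
             = mass (a + (n - m)) m.
  rewrite -(big_mkord (fun i => n - i < l.+1)%N
    (fun i => lam ^+ N (a + i) (n - i))).
  rewrite (@big_cat_nat _ _ _ (n - m)) ?leq_subr //=.
  rewrite big_nat_cond big_pred0 ?add0r; last by move=> i; rewrite /m; lia.
  rewrite -{1}[(n - m)%N]add0n big_addn subKn // big_mkord /mass.
  apply: eq_big => [i|i _]; first by have := ltn_ord i; rewrite /m; lia.
  by congr (lam ^+ N _ _); have := ltn_ord i; lia.
have DS : D l.+1 <= lam * D r + (lam - 1) * mass (a + (n - m)) m.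
  rewrite -massE /D !mulr_sumr (big_mkcond (fun i : 'I_n => n - i < l.+1)%N) /=.
  rewrite -big_split /=; apply: ler_sum => i _.
  case: ltnP => [nil|lni]; last first.
    rewrite (maxn_idPl (leq_trans (ltnW rl) lni)).
    by rewrite !subrr mulr0 addr0.
  have : lam ^+ N (a + i) l.+1 <= lam * lam ^+ N (a + i) (maxn (n - i) r).
    rewrite -exprS ler_weXn2l ?ltW//.
    apply: leq_trans (N_shrink _ _) _; rewrite ltnS; apply: N_mono.
    by rewrite leq_maxr.
  by move=> ?; lra.
rewrite DE lerD2l; apply: le_trans DS _.
have Sm : mass (a + (n - m)) m <= C * l.+1%:R.
  apply: le_trans (massC _ mn ml) _.
  by rewrite ler_wpM2l // ler_nat ltnW.
have rt := (truncn_shrink l.+1); rewrite -/r in rt.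
have lam0 : 0 < lam := lt_trans ltr01 lam_gt1.
apply: le_trans (_ : lam * (eps * C * (theta * l.+1%:R)) +
                     (lam - 1) * (C * l.+1%:R) <= _).
  apply: lerD; last by apply: ler_wpM2l => //; rewrite subr_ge0 ltW.
  apply: (ler_wpM2l (ltW lam0)); apply: le_trans Dr _.
  by rewrite ler_wpM2l // mulr_ge0 // ltW.
have -> : lam * (eps * C * (theta * l.+1%:R)) + (lam - 1) * (C * l.+1%:R) =
  (lam - 1 + lam * eps * theta) * (C * l.+1%:R) by ring.
by rewrite -[eps * C * _]mulrA ler_wpM2r // mulr_ge0.
Qed.

Variables (Q : nat -> nat -> bool) (Phi : nat -> nat -> R).
Hypothesis N_end : forall y e, (0 < N y e)%N ->
  exists l, [/\ (0 < l <= e)%N, Q y l & (N y e <= N y l)%N].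
Hypothesis Phi_super : forall a m m',
  Phi a m + Phi (a + m)%N m' <= Phi a (m + m')%N.
Hypothesis Phi_ge : forall a m, m%:R <= Phi a m.

(** [N_end] says that the count is attained at the end of a [Q]-interval. Let
    [J] be the longest [Q]-interval inside an interval [K]. By maximality no count
    in [K] changes when windows are limited to [|J|], so cutting [K] into the
    part left of [J], [J] and the part right of [J] creates two overhangs of
    length at most [|J|], one at each end of [J], whose cost is charged to [J].
    The outer parts are treated in the same way, until no [Q]-interval is left
    and the mass is the length. A superadditive [Phi] adds up the
    contributions of the pieces. *)
Lemma mass_le_superadditive a0 n0 :
  (forall a m, (m < n0)%N -> mass a m <= C * m%:R) ->
  (forall y m, (a0 <= y)%N -> (y + m <= a0 + n0)%N -> (0 < m)%N -> Q y m ->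
     mass y m + 2 * (eps * C * m%:R) <= Phi y m) ->
  mass a0 n0 <= Phi a0 n0.
Proof.
move=> massC PhiQ.
have lam1 : 1 <= lam by exact: ltW.
suff H n a : (a0 <= a)%N -> (a + n <= a0 + n0)%N -> mass a n <= Phi a n.
  by apply: H.
elim/ltn_ind: n a => n IH a a0a an.
pose P l := [exists i : 'I_n, [&& (0 < l)%N, (i + l <= n)%N & Q (a + i)%N l]].
have Pn l : P l -> (l <= n)%N by case/existsP => i /and3P[_ il _]; lia.
have N_P i e : (i < n)%N -> (e <= n - i)%N -> (0 < N (a + i) e)%N ->
    exists2 l, P l & (N (a + i) e <= N (a + i) l)%N.
  move=> ni en /N_end[l [/andP[l0 le] Ql Nl]]; exists l => //.
  by apply/existsP; exists (Ordinal ni); rewrite /= l0 Ql andbT /=; lia.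
have [exP|nP] := pselect (exists l, P l); last first.
  apply: le_trans (Phi_ge a n); rewrite /mass.
  apply: (@le_trans _ _ (\sum_(i < n) 1)); last by rewrite sumr_const card_ord.
  apply: ler_sum => i _; have [->//|] := posnP (N (a + i) (n - i)).
  by case/(N_P i _ (ltn_ord i) (leqnn _)) => l Pl; case: nP; exists l.
have [l Pl lmax] := ex_maxnP exP Pn.
(* By maximality of [l], windows longer than [l] are useless. *)
have Nl i : (i < n)%N -> (N (a + i) (n - i) <= N (a + i) l)%N.
  move=> ni; have [->//|] := posnP (N (a + i) (n - i)).
  case/(N_P i _ ni (leqnn _)) => l' /lmax l'l Nl'.
  by apply: leq_trans Nl' _; exact: N_mono.
(* The interval [J] is [a + x, a + x + l). *)
case/existsP: (Pl) => -[x xn] /= /and3P[l0 xl Ql].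
have cut b m : (b + m <= n)%N -> (forall k, (k <= m)%N -> (k < l)%N ->
      mass (a + b + (m - k)) k <= C * k%:R) ->
    \sum_(i < m) lam ^+ N (a + b + i) (n - b - i) <=
    mass (a + b) m + eps * C * l%:R.
  move=> bm mC; apply: le_trans (overhang_mass mC).
  apply: ler_sum => i _; apply: ler_weXn2l => //.
  have im := ltn_ord i.
  have := @Nl (b + i)%N; rewrite addnA subnDA => H.
  by apply: leq_trans (H _) _; [clear -im bm; lia | apply: N_mono; clear -im; lia].
have ln0 : (l <= n0)%N by clear -xl an a0a; lia.
have nE : n = (x + (l + (n - x - l)))%N by clear -xl; lia.
move: nE; move: (n - x - l)%N => z nE.
have left_le : \sum_(i < x) lam ^+ N (a + i) (n - i) <=
    mass a x + eps * C * l%:R.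
  have := cut 0%N x; rewrite addn0 subn0; apply; first by clear -xn; lia.
  by move=> k _ kl; apply: massC; exact: leq_trans ln0.
have mid_le : \sum_(i < l) lam ^+ N (a + x + i) (n - x - i) <=
    mass (a + x) l + eps * C * l%:R.
  apply: cut => // k _ kl; apply: massC; exact: leq_trans ln0.
have massE : mass a n =
    \sum_(i < x) lam ^+ N (a + i) (n - i) +
    (\sum_(i < l) lam ^+ N (a + x + i) (n - x - i) + mass (a + x + l) z).
  rewrite nE mass_split mass_split; congr (_ + (_ + _)).
  by apply: eq_bigr => i _; congr (lam ^+ N _ _); rewrite addKn.
have PhiE : Phi a x + (Phi (a + x)%N l + Phi (a + x + l)%N z) <= Phi a n.
  by rewrite nE; apply: le_trans (Phi_super _ _ _); rewrite lerD2l.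
have IHx : mass a x <= Phi a x by apply: IH => //; clear -an xn nE; lia.
have IHz : mass (a + x + l) z <= Phi (a + x + l)%N z.
  by apply: IH; clear -an a0a l0 nE; lia.
have IHl : mass (a + x) l + 2 * (eps * C * l%:R) <= Phi (a + x)%N l.
  by apply: PhiQ => //; clear -an a0a nE; lia.
rewrite massE; apply: le_trans (lerD left_le (lerD mid_le IHz)) _.
apply: le_trans PhiE; apply: le_trans (lerD IHx (lerD IHl (lexx _))).
by rewrite mulrDl mul1r -!addrA lerD2l addrCA.
Qed.

End Mass.

(** * The deterministic bound *)

(** The last inequality closes the induction of [fluctuation_mass_bound]: its left
    side bounds the mass per unit length of a low interval, plus the cost of
    cutting around it. To first order it says that [1 + theta C <= C], so it
    suffices that [eps] and [lam - 1] are small compared with [1 - theta]. *)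
Lemma mass_constants (R : realType) (theta : R) : 0 < theta < 1 ->
  exists lam eps C : R, [/\ 1 < lam, 0 < eps, 1 <= C,
    lam - 1 + lam * eps * theta <= eps &
    1 + (lam + 2 * (eps * lam)) * C * theta + 2 * (eps * C) <= C].
Proof.
move=> /andP[t0 t1].
pose eps := (1 - theta) / 16; pose lam := 1 + eps * (1 - theta) / 2.
have eps0 : 0 < eps by rewrite /eps; lra.
have eps1 : eps < 1 / 16 by rewrite /eps; lra.
have lam1 : 1 < lam by rewrite /lam; nra.
have lam2 : lam <= 1 + eps / 2 by rewrite /lam; nra.
have lam3 : lam - 1 + lam * eps * theta <= eps.
  rewrite -subr_ge0 (_ : _ - _ = eps * ((1 - theta) / 2) * (1 - eps * theta)).
    by rewrite !mulr_ge0 //; nra.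
  by rewrite /lam; field.
pose A := (lam + 2 * (eps * lam)) * theta + 2 * eps.
have A0 : 0 < A by rewrite /A; nra.
have A1 : A < 1.
  have : lam + 2 * (eps * lam) <= 1 + 4 * eps by nra.
  by rewrite /A => H; have : eps = (1 - theta) / 16 by []; nra.
exists lam, eps, (1 - A)^-1; split => //.
  by rewrite -invr1 lef_pV2 ?posrE; lra.
set C := (1 - A)^-1.
have -> : 1 + (lam + 2 * (eps * lam)) * C * theta + 2 * (eps * C) = 1 + A * C
  by rewrite /A; ring.
have : (1 - A) * C = 1 by rewrite /C mulfV //; lra.
lra.
Qed.

Section Fluctuations.
Variables (R : realType) (alpha beta : R).
Hypothesis alpha_gt0 : 0 < alpha.
Hypothesis alpha_beta : alpha < beta.

(** The constants depend on [alpha] and [beta] only. The predicates [hi] and [lo]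
    are kept apart from [Y] so that crossings can be expressed by the averages
    of the array, as in the events whose probability is sought. *)
Lemma fluctuation_mass_bound : exists lam C : R, [/\ 1 < lam, 0 <= C &
  forall (Y : nat -> nat -> R) (hi lo : nat -> pred nat),
    (forall y e, 0 <= Y y e) ->
    (forall y e f, Y y e + Y (y + e)%N f <= Y y (e + f)%N) ->
    (forall y h, (0 < h)%N -> hi y h -> beta * h%:R < Y y h) ->
    (forall y l, (0 < l)%N -> lo y l -> Y y l < alpha * l%:R) ->
    forall a n, mass lam (fun y => count_lo (hi y) (lo y)) a n <= C * n%:R].
Proof.
have beta0 : 0 < beta by exact: lt_trans alpha_beta.
pose theta := alpha / beta.
have theta01 : 0 < theta < 1.
  by rewrite divr_gt0 //= ltr_pdivrMr // mul1r.
have [lam [eps [C [lam1 eps0 C1 lam_eps C_eps]]]] := mass_constants theta01.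
have lam0 : 0 < lam by exact: lt_trans lam1.
have C0 : 0 <= C by exact: le_trans C1.
exists lam, C; split => // Y hi lo Y0 YD hiY loY.
pose Nlo y := count_lo (hi y) (lo y); pose Nhi y := count_hi (hi y) (lo y).
(* High inside low: [beta h < Y y h <= Y y l < alpha l]. *)
have shrink y e h l : (0 < h)%N -> (h < l <= e)%N -> hi y h -> lo y l ->
    (h <= Num.truncn (theta * e%:R))%N.
  move=> h0 /andP[hl le] /hiY H /loY L.
  have {H L}: beta * h%:R < alpha * l%:R.
    apply: lt_trans (H h0) _; apply: le_lt_trans (L (leq_ltn_trans (leq0n _) hl)).
    rewrite -(subnKC (ltnW hl)); apply: le_trans (YD _ _ _).
    by rewrite lerDl.
  rewrite mulrC -ltr_pdivlMr // mulrAC -/theta => H.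
  rewrite truncn_ge_nat //; last by rewrite mulr_ge0 // ltW //; case/andP: theta01.
  apply: ltW; apply: lt_le_trans H _; rewrite ler_wpM2l ?ler_nat //.
  by apply: ltW; case/andP: theta01.
have lo_le_hi a n : mass lam Nlo a n <= mass lam Nhi a n.
  apply: ler_sum => i _; apply: ler_weXn2l; first exact: ltW.
  exact: count_lo_hi.
have hi_le_lo a n : mass lam Nhi a n <= lam * mass lam Nlo a n.
  rewrite /mass mulr_sumr; apply: ler_sum => i _; rewrite -exprS.
  apply: ler_weXn2l; first exact: ltW.
  exact: count_hi_lo.
move=> a n; rewrite -/Nlo; elim/ltn_ind: n a => n IH a.
(* A low interval is exhausted by high ones; these cannot fill it, so the
   induction hypothesis applies to each of them. *)
have low_mass y m : (0 < m <= n)%N -> lo y m ->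
    mass lam Nlo y m + 2 * (eps * C * m%:R) <= C * m%:R.
  move=> /andP[m0 mn] lom.
  (* The mass per unit of [Y]: a high interval of length [k] has
     [Y > beta k]. *)
  pose D := (lam + 2 * (eps * lam)) * C / beta.
  have D0 : 0 <= D.
    by rewrite divr_ge0 ?(ltW beta0)// mulr_ge0 // addr_ge0 ?mulr_ge0 ?ltW.
  have IHhi b k : (k < m)%N -> mass lam Nhi b k <= lam * C * k%:R.
    move=> km; apply: le_trans (hi_le_lo _ _) _; rewrite -mulrA.
    by apply: (ler_wpM2l (ltW lam0)); apply: IH; exact: leq_trans mn.
  have mass_hi_le : mass lam Nhi y m <= m%:R + D * Y y m.
    apply: (@mass_le_superadditive _ _ _ eps theta (lam * C) _ _ _ _ _ _ _ hi
      (fun y m => m%:R + D * Y y m)) => //.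
    - by rewrite mulr_ge0 // ltW.
    - by move=> z e e'; exact: count_hi_mono.
    - by move=> z e; apply: count_hi_shrink => h l; exact: shrink.
    - by move=> z e; exact: count_hi_end.
    - move=> b k k'; rewrite natrD addrACA -mulrDr lerD2l.
      exact: ler_wpM2l.
    - by move=> b k; rewrite lerDl mulr_ge0.
    - move=> z k yz zk k0 hik.
      have km : (k < m)%N.
        rewrite ltn_neqAle; apply/andP; split; last by clear -yz zk; lia.
        apply/eqP => kE; have zE : z = y by clear -yz zk kE; lia.
        move: hik; rewrite zE kE => /(hiY _ _ m0) /lt_trans /(_ (loY _ _ m0 lom)).
        by rewrite ltr_pM2r ?ltr0n // ltNge ltW.
      have DY : D * (beta * k%:R) <= D * Y z k.
        by apply: ler_wpM2l => //; exact: ltW (hiY _ _ k0 hik).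
      have DE : D * (beta * k%:R) = lam * C * k%:R + 2 * (eps * (lam * C) * k%:R).
        by rewrite /D; field; rewrite gt_eqF.
      apply: le_trans (lerD (IHhi _ _ km) (lexx _)) _; rewrite -DE.
      by apply: le_trans DY _; rewrite lerDr.
  have DY : D * Y y m <= (lam + 2 * (eps * lam)) * C * theta * m%:R.
    rewrite (_ : _ * m%:R = D * (alpha * m%:R)).
      by apply: ler_wpM2l => //; exact: ltW (loY _ _ m0 lom).
    by rewrite /D /theta; field; rewrite gt_eqF.
  apply: le_trans (lerD (le_trans (lo_le_hi _ _) mass_hi_le) (lexx _)) _.
  apply: le_trans (_ : (1 + (lam + 2 * (eps * lam)) * C * theta +
    2 * (eps * C)) * m%:R <= _); last by rewrite ler_wpM2r.
  by rewrite !(mulrDl _ _ m%:R) mul1r -[2 * (eps * C) * _]mulrA lerD2r lerD2l.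
(* An arbitrary interval is exhausted by low ones. *)
apply: (@mass_le_superadditive _ _ _ eps theta C _ _ _ _ _ _ _ lo
      (fun y m => C * m%:R)) => //.
- by move=> z e e'; exact: count_lo_mono.
- by move=> z e; apply: count_lo_shrink => h l; exact: shrink.
- by move=> z e; exact: count_lo_end.
- by move=> b k k'; rewrite natrD mulrDr.
- by move=> b k; rewrite ler_peMl.
- by move=> b k kn; apply: IH.
- move=> z k az zk k0 lok; apply: low_mass => //.
  by rewrite k0 /=; clear -az zk; lia.
Qed.

End Fluctuations.

(** * Upcrossings as measurable events *)

Definition crossing_chain (R : realType) (s t : R) (x : nat -> R) :
    nat -> nat -> bool :=
  chain (fun h => x h < s) (fun l => t < x l).

(** This turns the existence of index functions into a countable union of
    finitary, hence measurable, events. *)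
Lemma has_upcrossingsP (R : realType) (s t : R) (x : nat -> R) k :
  has_upcrossings x s t k <-> exists e, crossing_chain s t x k.*2 e.
Proof.
rewrite /crossing_chain; split=> [[i [j [i1 ij ji xij]]]|[e]].
  pose prev m := if m is m'.+1 then j m else 0%N.
  exists (prev k); have := leqnn k; move: {1 3 4}k.
  elim=> // m IHm mk.
  have m1k : (1 <= m.+1 <= k)%N by [].
  have [xi xj] := xij _ m1k; have im := ij _ m1k.
  have lim : (prev m < i m.+1)%N.
    case: m {IHm xi xj im m1k} mk => [|m] mk //=.
    exact: ji.
  apply/chain_pairP; exists (i m.+1), (j m.+1); split => //.
  - by apply/andP; split => //; exact: leq_ltn_trans lim.
  - by apply: chain_widen (IHm (ltnW mk)); clear -lim; lia.
suff: chain (fun h => x h < s) (fun l => t < x l) k.*2 e -> exists i j : nat -> nat,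
    [/\ (0 < k)%N -> (j k <= e)%N, (1 <= i 1)%N,
      forall m, (1 <= m <= k)%N -> (i m < j m)%N,
      forall m, (1 <= m < k)%N -> (j m < i m.+1)%N &
      forall m, (1 <= m <= k)%N -> x (i m) < s /\ t < x (j m)].
  by move=> H /H[i [j [_ *]]]; exists i, j; split.
elim: k e => [|k IHk] e.
  by move=> _; exists (fun=> 1%N), (fun=> 1%N); split => // m; lia.
case/chain_pairP => h [l [/andP[h0 hl] le xh xl /IHk]].
move=> [i [j [jk i1 ij ji xij]]].
exists (fun m => if m == k.+1 then h else i m).
exists (fun m => if m == k.+1 then l else j m).
split=> [_|||m mk|m mk].
- by rewrite eqxx.
- by case: ifP.
- move=> m mk; case: eqP => [//|mk'].
  by apply: ij; lia.
- rewrite eqSS; case: eqP => [?|mk']; first by lia.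
  case: eqP => [mE|?]; last by apply: ji; lia.
  by rewrite mE; have := jk; clear -mk mE h0; lia.
- case: eqP => [_|mk'] //.
  by apply: xij; lia.
Qed.

Lemma measurable_crossing_chain d (T : measurableType d) (R : realType) (s t : R)
    (f : nat -> T -> R) n e :
  (forall h, (0 < h)%N -> measurable_fun setT (f h)) ->
  measurable [set w | crossing_chain s t (fun h => f h w) n e].
Proof.
move=> mf; elim: n e => [|n IHn] e.
  by rewrite (_ : [set _ | _] = setT) //; apply/seteqP; split.
rewrite (_ : [set _ | _] = \bigcup_(i in `I_e)
    ([set w | if odd n.+1 then f i.+1 w < s else t < f i.+1 w] `&`
     [set w | crossing_chain s t (fun h => f h w) n i])); last first.
  apply/seteqP; split=> w /=.
    by case/chainSP => i [ie ai ci]; exists i.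
  by case=> i /= ie [ai ci]; apply/chainSP; exists i.
apply: bigcup_measurable => i _; apply: measurableI => //.
have mfi := mf i.+1 isT measurableT.
case: (odd n.+1).
  by have := mfi `]-oo, s[%classic (measurable_itv _); rewrite setTI set_itvE.
by have := mfi `]t, +oo[%classic (measurable_itv _); rewrite setTI set_itvE.
Qed.

(** * Consequences of stationarity *)

Section Stationary.
(* This makes the type of arrays pointed, as the type carrying a generated
   sigma-algebra has to be. *)
Import numFieldNormedType.Exports.
Variables (d : measure_display) (T : measurableType d) (R : realType).
Variables (P : probability T R) (X : nat -> nat -> {RV P >-> R}).
Hypothesis statX : stationary_array X.

Definition shifted_average y w h : R := X (1 + y)%N (h + y)%N w / h%:R.

Lemma shifted_average0 w :
  shifted_average 0 w = (fun h => X 1%N h w / h%:R).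
Proof. by apply/funext => h; rewrite /shifted_average !addn0. Qed.

Lemma measurable_shifted_crossing s t y n e :
  measurable [set w | crossing_chain s t (shifted_average y w) n e].
Proof.
apply: (measurable_crossing_chain _ _ _ _ (f := fun h w => shifted_average y w h)).
move=> h _; apply: measurable_funM; last exact: measurable_cst.
exact: measurable_funPT.
Qed.

Lemma stationary_crossing s t y n e :
  P [set w | crossing_chain s t (shifted_average y w) n e] =
  P [set w | crossing_chain s t (shifted_average 0 w) n e].
Proof.
pose A : set (nat -> nat -> R) :=
  [set x | crossing_chain s t (fun h => x 1%N h / h%:R) n e].
have mA : <<s @array_cylinder R >> A.
  have := @measurable_crossing_chain _ (g_sigma_algebraType (@array_cylinder R))
    R s t (fun h x => x 1%N h / h%:R) n e; apply => h h0.
  apply: measurable_funM => //; move=> _ B mB; rewrite setTI.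
  by apply: sub_sigma_algebra; exists 1%N, h, B; split.
transitivity (P ((fun w m n => X (m + y)%N (n + y)%N w) @^-1` A)) => //.
rewrite -(statX y mA); congr (P _); apply/seteqP; split => w;
  by rewrite /A /= shifted_average0.
Qed.

Lemma stationary_bounded M y : {ae P, forall w, X 1%N 1%N w <= M} ->
  {ae P, forall w, X (1 + y)%N (1 + y)%N w <= M}.
Proof.
move=> XM.
pose A : set (nat -> nat -> R) := [set x | M < x 1%N 1%N].
have mA : <<s @array_cylinder R >> A.
  apply: sub_sigma_algebra; exists 1%N, 1%N, `]M, +oo[%classic; split => //.
  by rewrite set_itvE.
have mX m n : measurable [set w | M < X m n w].
  have := measurable_funPT (X m n) measurableT _
    (measurable_itv `]M, +oo[).
  by rewrite setTI set_itvE.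
have H m n : P [set w | M < X m n w] = 0%E <-> {ae P, forall w, X m n w <= M}.
  have E : ~` [set w | X m n w <= M] = [set w | M < X m n w].
    by apply/seteqP; split => w /=; rewrite ltNge => /negP.
  by rewrite -(negligibleP _ (mX m n)) -E.
apply/H; rewrite -(statX y mA); exact/H.
Qed.

End Stationary.

Lemma sum_measure_le d (T : measurableType d) (R : realType) (P : probability T R)
    (A : nat -> set T) n (K : R) : (forall i, measurable (A i)) -> 0 <= K ->
  {ae P, forall w, \sum_(i < n) \1_(A i) w <= K} ->
  (\sum_(i < n) P (A i) <= K%:E)%E.
Proof.
move=> mA K0 AK.
have mI i : measurable_fun setT (fun w => (\1_(A i) w)%:E : \bar R).
  by apply/measurable_EFinP; exact: measurable_indic.
rewrite (_ : (\sum_(i < n) P (A i))%E = \int[P]_w \sum_(i < n) (\1_(A i) w)%:E)%E.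
  rewrite -[leRHS]mule1 -(probability_setT P) -integral_cst //.
  apply: ae_ge0_le_integral => //.
  - by move=> w _; apply: sume_ge0 => i _; rewrite lee_fin.
  - by apply: emeasurable_sum.
  - by move: AK; apply: filterS => w AK _; rewrite sumEFin lee_fin.
rewrite ge0_integral_sum //.
by apply: eq_bigr => i _; rewrite integral_indic // setIT.
Qed.

(** * From counting to probability *)

Section Upcrossings.
Variables (d : measure_display) (T : measurableType d) (R : realType).
Variables (P : probability T R) (X : nat -> nat -> {RV P >-> R}).
Variables (s t M lam C : R).
Hypothesis statX : stationary_array X.
Hypothesis subX : subadditive_array X.
Hypothesis X_le : {ae P, forall w, X 1%N 1%N w <= M}.
Hypothesis tM : t < M.
Hypothesis lam_gt1 : 1 < lam.
Hypothesis C_ge0 : 0 <= C.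
Hypothesis massC : forall (Y : nat -> nat -> R) (hi lo : nat -> pred nat),
    (forall y e, 0 <= Y y e) ->
    (forall y e f, Y y e + Y (y + e)%N f <= Y y (e + f)%N) ->
    (forall y h, (0 < h)%N -> hi y h -> (M - s) * h%:R < Y y h) ->
    (forall y l, (0 < l)%N -> lo y l -> Y y l < (M - t) * l%:R) ->
    forall a n, mass lam (fun y => count_lo (hi y) (lo y)) a n <= C * n%:R.

(** An empty interval has no entry in the array, whence the case [e = 0]. *)
Definition deficit w y e : R :=
  if e == 0%N then 0 else M * e%:R - X (1 + y)%N (e + y)%N w.

Lemma deficit_crossing_mass : {ae P, forall w a n,
  mass lam (fun y => count_lo (fun h => shifted_average X y w h < s)
                              (fun l => t < shifted_average X y w l)) a n
    <= C * n%:R}.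
Proof.
have sub : {ae P, forall w k m n, (0 < k)%N -> (k <= m < n)%N ->
    X k n w <= X k m w + X m.+1 n w}.
  apply: ae_foralln => k; apply: ae_foralln => m; apply: ae_foralln => n.
  have [k0|] := ltnP 0 k; last by move=> ?; apply: aeW.
  have [/andP[km mn]|h] := boolP (k <= m < n)%N; last by apply: aeW.
  by have := subX k0 km mn; apply: filterS => w.
have diag : {ae P, forall w y, X (1 + y)%N (1 + y)%N w <= M}.
  by apply: ae_foralln => y; exact: stationary_bounded.
apply: filterS2 sub diag => w sub diag.
apply: (massC (Y := deficit w)).
- move=> y; elim=> [|e IHe]; first by rewrite /deficit eqxx.
  rewrite /deficit /=; have := diag (e + y)%N; rewrite add1n => De.
  move: IHe; rewrite /deficit; case: eqP => [->|e0] IHe.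
    by rewrite mulr1 subr_ge0; exact: diag.
  have := sub (1 + y)%N (e + y)%N (e.+1 + y)%N isT.
  rewrite -natr1 mulrDr mulr1 addSn => H.
  have {}H : X (1 + y)%N (e + y).+1 w <=
      X (1 + y)%N (e + y)%N w + X (e + y).+1 (e + y).+1 w.
    by apply: H; clear -e0; lia.
  by lra.
- move=> y e f; rewrite /deficit addn_eq0.
  have [->|e0] := eqVneq e 0%N; first by rewrite add0r addn0 add0n.
  have [->|f0] := eqVneq f 0%N; first by rewrite addr0 addn0.
  have := sub (1 + y)%N (e + y)%N (e + f + y)%N isT.
  rewrite /= (_ : (1 + (y + e) = (e + y).+1)%N); last by clear; lia.
  rewrite (_ : (f + (y + e) = e + f + y)%N); last by clear; lia.
  rewrite natrD mulrDr => H.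
  have {}H : X (1 + y)%N (e + f + y)%N w <=
      X (1 + y)%N (e + y)%N w + X (e + y).+1 (e + f + y)%N w.
    by apply: H; clear -e0 f0; lia.
  by lra.
- move=> y h h0; rewrite /shifted_average /deficit gtn_eqF // => H.
  move: H; rewrite ltr_pdivrMr ?ltr0n // mulrBl.
  by move: (X _ _ _) (M * _) (s * _) => ? ? ? H; lra.
- move=> y h h0; rewrite /shifted_average /deficit gtn_eqF // => H.
  move: H; rewrite ltr_pdivlMr ?ltr0n // mulrBl.
  by move: (X _ _ _) (M * _) (t * _) => ? ? ? H; lra.
Qed.

(** The events that [k] upcrossings start at [y] within a window [L] all have the
    same probability [p]. At most [C lam^-k (n + L)] of the points [y < n] see
    such an event, since each contributes [lam^k] to the mass of [[0, n + L)].
    So [n p <= C lam^-k (n + L)], and [n] is arbitrary. *)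
Lemma windowed_upcrossing_bound k L :
  (P [set w | crossing_chain s t (shifted_average X 0 w) k.*2 L]
     <= (C * lam ^- k)%:E)%E.
Proof.
pose A y := [set w | crossing_chain s t (shifted_average X y w) k.*2 L].
have mA y : measurable (A y) by exact: measurable_shifted_crossing.
have lam0 : 0 < lam := lt_trans ltr01 lam_gt1.
have lamk : 0 < lam ^+ k by rewrite exprn_gt0.
have PA n : (\sum_(i < n) P (A i) <= (C * lam ^- k * (n + L)%:R)%:E)%E.
  apply: sum_measure_le => //; first by rewrite !mulr_ge0 // invr_ge0 ltW.
  have := deficit_crossing_mass; apply: filterS => w /(_ 0%N (n + L)%N) massw.
  rewrite mulrAC ler_pdivlMr //; apply: le_trans massw.
  rewrite mass_split mulr_suml -[leLHS]addr0; apply: lerD; last first.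
    by apply: sumr_ge0 => i _; rewrite exprn_ge0 // ltW.
  apply: ler_sum => i _; rewrite indicE; case: (boolP (w \in A _)) => [|_].
    rewrite inE mul1r => Ai; apply: ler_weXn2l; first exact: ltW.
    rewrite add0n; apply: leq_count_lo; apply: chain_widen Ai.
    by have := ltn_ord i; clear; lia.
  by rewrite mul0r exprn_ge0 // ltW.
have PA0 : P (A 0%N) = (fine (P (A 0%N)))%:E by rewrite fineK // fin_num_measure.
rewrite PA0 lee_fin leNgt; apply/negP; set p := fine _; set q := C * _ => qp.
(* For this [n], [n p] would exceed [q (n + L)]. *)
pose n := Num.bound (q * L%:R / (p - q)).
have := PA n; rewrite (eq_bigr (fun=> p%:E)); last first.
  by move=> i _; rewrite -PA0; exact: stationary_crossing.
rewrite sumEFin lee_fin sumr_const card_ord -/q natrD.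
have : q * L%:R / (p - q) < n%:R.
  by apply: archi_boundP; rewrite !mulr_ge0 ?invr_ge0 ?subr_ge0 // ltW.
rewrite ltr_pdivrMr ?subr_gt0 // -[p *+ n]mulr_natl.
by move=> H1 H2; move: (n%:R) (L%:R) H1 H2 => N' L' H1 H2; lra.
Qed.

Lemma upcrossing_bound k :
  (P [set w | has_upcrossings (fun n : nat => (X 1%N n w / n%:R)%R) s t k]
     <= (C * lam ^- k)%:E)%E.
Proof.
pose A L := [set w | crossing_chain s t (shifted_average X 0 w) k.*2 L].
have mA L : measurable (A L) by exact: measurable_shifted_crossing.
rewrite (_ : [set w | _] = \bigcup_L A L); last first.
  apply/seteqP; split => w /=.
    by case/has_upcrossingsP => e c; exists e => //; rewrite /A /= shifted_average0.
  case=> e _; rewrite /A /= shifted_average0 => c.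
  by apply/has_upcrossingsP; exists e.
have cvgA : (P \o A) x @[x --> \oo] --> P (\bigcup_L A L).
  apply: nondecreasing_cvg_mu => //; first exact: bigcupT_measurable.
  by move=> L L' LL'; apply/subsetPset => w; exact: chain_widen.
rewrite -(cvg_lim _ cvgA) //; apply: lime_le.
  by apply/cvg_ex; eexists; exact: cvgA.
by apply: nearW => L; exact: windowed_upcrossing_bound.
Qed.

End Upcrossings.

Theorem theorem1p2 (R : realType) (s t M : R) (hst : s < t) :
  exists c rho : R, 0 < rho < 1 /\
    forall (d : measure_display) (T : measurableType d) (P : probability T R)
      (X : nat -> nat -> {RV P >-> R}),
      stationary_array X ->
      subadditive_array X ->
      {ae P, forall w, X 1%N 1%N w <= M} ->
      forall k : nat, (0 < k)%N ->
        (P [set w | has_upcrossings (fun n : nat => (X 1%N n w / n%:R)%R) s t k]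
           < (c * rho ^+ k)%:E)%E.
Proof.
(* With [t < M'], low intervals have a positive threshold [M' - t]. *)
pose M' := Num.max M (t + 1).
have tM : t < M' by rewrite /M' lt_max ltrDl ltr01 orbT.
have alpha_gt0 : 0 < M' - t by rewrite subr_gt0.
have alpha_beta : M' - t < M' - s by rewrite ltrD2l ltrN2.
have [lam [C [lam1 C0 massC]]] := fluctuation_mass_bound alpha_gt0 alpha_beta.
(* [C + 1] instead of [C] makes the inequality strict. *)
exists (C + 1), lam^-1; split.
  by rewrite invr_gt0 invf_lt1 ?lam1 ?(lt_trans ltr01).
move=> d T P X statX subX X_le k _.
have X_le' : {ae P, forall w, X 1%N 1%N w <= M'}.
  by apply: filterS X_le => w /le_trans; apply; rewrite /M' le_max lexx.
apply: le_lt_trans (upcrossing_bound statX subX X_le' lam1 C0 massC k) _.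
by rewrite lte_fin exprVn ltr_pM2r ?ltrDl// invr_gt0 exprn_gt0 // (lt_trans ltr01).
Qed.
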